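(* Let $n \in \mathbb{Z}^+$, and let $M$ be some fixed multiset of size $n$. Let $A$ be the set of all permutations of $M$ (i.e. all words $a_1a_2\ldots a_n$ whose multiset of letters is $M$). Then there exists a universal cycle for $A$ using the prefix representation, i.e. a universal cycle for the set $A^- = \{a_1a_2\ldots a_{n-1} \mid a_1a_2\ldots a_n \in A\}$.
   Context: Prefix representation: since the multiset $M$ is fixed, each word $a = a_1\ldots a_n \in A$ is determined by its prefix $a^- = a_1\ldots a_{n-1}$ and is represented by it; strings in $A^-$ have length $n-1$. Let $\mathcal{C}$ be a set of $N$ strings, each of length $m$. A universal cycle (ucycle) for $\mathcal{C}$ is a word $a_0a_1\ldots a_{N-1}$ such that each $c \in \mathcal{C}$ appears exactly once as a subword $a_{i+1}a_{i+2}\ldots a_{i+m}$ (one value of $i$ modulo $N$), where subscripts are taken modulo $N$. (In particular every such subword is a string in $\mathcal{C}$.) *)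

(* Defs.v *)
From mathcomp Require Import all_boot finmap multiset.

Set Implicit Arguments.
Unset Strict Implicit.
Unset Printing Implicit Defensive.

Local Open Scope fset_scope.
Local Open Scope mset_scope.
Local Open Scope nat_scope.

Section UniversalCycles.

Variable T : choiceType.

Definition mset_perms (M : {mset T}) : {fset seq T} :=
  [fset a in permutations (enum_mset M)].

Lemma mset_permsP (M : {mset T}) (a : seq T) :
  reflect (seq_mset a = M) (a \in mset_perms M).
Proof.
rewrite !inE mem_permutations.
apply: (iffP idP) => [aM | <-]; last by rewrite perm_sym; exact: perm_eq_seq_mset.
by rewrite -[RHS]seq_mset_id; apply/eq_seq_msetP.
Qed.

Definition prefix_repr (n : nat) (A : {fset seq T}) : {fset seq T} :=
  [fset take n.-1 a | a in A].

(* The letters u_(i+1), ..., u_(i+m), with subscripts modulo N; m may exceed N.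
   The default tnth u i of nth is never reached. *)
Definition cyclic_subword (N : nat) (u : N.-tuple T) (m : nat) (i : 'I_N) :
    seq T :=
  [seq nth (tnth u i) u ((i + j.+1) %% N) | j <- iota 0 m].

(* Every cyclic_subword u m i has size m, so this can only hold when all the
   strings of C have length m. *)
Definition is_ucycle (m : nat) (C : {fset seq T}) (u : #|` C|.-tuple T) : Prop :=
  forall c : seq T, c \in C -> exists! i : 'I_(#|` C|), cyclic_subword u m i = c.

End UniversalCycles.

(* Main.v *)
(** The rotation of a word, and its rotation after exchanging its first and last
    letters, are the two words whose prefix may follow its own in a universal
    cycle. Among the permutations of the words of [A] that send each word to one
    of these two, take one with the fewest orbits: any word and the word with
    its end letters exchanged lie in the same orbit, since otherwise exchanging
    their images would merge two orbits. Hence an orbit is stable under rotation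
    and under exchanging cyclically adjacent letters, so there is only one;
    reading the first letters along it gives the universal cycle. *)
Require Import Defs.
From mathcomp Require Import all_boot finmap multiset.
From mathcomp Require Import perm zify.

Local Open Scope fset_scope.
Local Open Scope mset_scope.
Local Open Scope nat_scope.

Lemma exists_transitive_perm (X : finType) (r : {perm X}) (t : X -> X) :
    involutive t ->
    (forall S : {set X}, {homo r : x / x \in S} -> {homo t : x / x \in S} ->
       {in S, forall x y, y \in S}) ->
  exists2 g : {perm X},
    forall x, g x = r x \/ g x = r (t x) & forall x y, y \in porbit g x.
Proof.
move=> tK trans; pose G (g : {perm X}) := [forall x, (g x == r x) || (g x == r (t x))].
have Gr : G r by apply/forallP => x; rewrite eqxx.
case: (@arg_minnP _ r G (fun g => #|porbits g|) Gr) => g /forallP Gg gmin.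
have gP x : g x = r x \/ g x = r (t x).
  by case/orP: (Gg x) => /eqP; [left | right].
have gt x : t x \in porbit g x.
  apply/idPn => tx.
  have xt : t x != x by apply: contraNneq tx => ->; exact: porbit_id.
  (* This exchanges the images of [x] and [t x], both still allowed because [t] is an involution. If
     the two points lay in distinct orbits, one orbit fewer would remain. *)
  have /gmin : G (tperm (t x) x * g)%g.
    apply/forallP => y; rewrite permM; case: tpermP => [->|->|_ _]; last exact: Gg.
      by case: (gP x) => ->; rewrite tK eqxx ?orbT.
    by case: (gP (t x)) => ->; rewrite ?tK eqxx ?orbT.
  by move: (porbits_mul_tperm g (t x) x); rewrite /= tx xt /=; lia.
exists g => // x y.
have tx z : z \in porbit g x -> t z \in porbit g x.
  by rewrite -eq_porbit_mem => /eqP<-.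
have gx z : z \in porbit g x -> g z \in porbit g x.
  by rewrite -eq_porbit_mem => /eqP<-; exact: (mem_porbit g 1).
(* Either [r z] is the image under [g] of [z] or of [t z], or both are sent to [r (t z)] and
   injectivity gives [t z = z]. *)
apply: (trans _ _ tx x) (porbit_id _ _) y => z zx.
case: (gP z) => gz; first by rewrite -gz gx.
case: (gP (t z)) => gtz; last by rewrite tK in gtz; rewrite -gtz gx ?tx.
by have tz : t z = z; [apply: (@perm_inj _ g); rewrite gtz gz | rewrite -tz -gtz gx ?tx].
Qed.

(** Conjugating the exchange of the first two letters by rotations gives every adjacent exchange,
    and these sort any word into any rearrangement of it. *)
Lemma perm_closure {T : eqType} (P : seq T -> Prop) :
    (forall s, P s -> P (rot 1 s)) ->
    (forall a b s, P [:: a, b & s] -> P [:: b, a & s]) ->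
  forall s s', perm_eq s s' -> P s -> P s'.
Proof.
move=> Prot Pswap.
have Prots k s : P s -> P (rot k s).
  elim: k => [|k IH] Ps; first by rewrite rot0.
  have [ks|sk] := ltnP k (size s); first by rewrite rotS //; apply: Prot; exact: IH.
  by rewrite rot_oversize // ltnW.
have Padj u a b v : P (u ++ [:: a, b & v]) -> P (u ++ [:: b, a & v]).
  move=> /(Prots (size u)); rewrite rot_size_cat => /Pswap /(Prots (size v).+2).
  by rewrite -[_.+2]/(size [:: b, a & v]) rot_size_cat.
have Pfront u p a q : P (u ++ p ++ a :: q) -> P (u ++ a :: p ++ q).
  elim/last_ind: p q => [//|p b IH] q; rewrite !cat_rcons => Ps.
  by apply: IH; rewrite catA; apply: Padj; rewrite -catA.
move=> s s' ss' Ps; rewrite -[s']cat0s; rewrite -[s]cat0s in Ps.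
(* The accumulator [u] is the part of the target already in place; the next target letter is moved
   left to its end. *)
elim: s' s [::] ss' Ps => [|a s' IH] s u ss'; first by rewrite (perm_nilP ss').
have a_s : a \in s by rewrite (perm_mem ss') mem_head.
case/path.splitPr: s / a_s ss' => p q ss' /Pfront; rewrite -!cat_rcons.
apply: IH; rewrite -(perm_cons a); apply: perm_trans ss'.
by rewrite -(cat1s a (p ++ q)) -(cat1s a q) perm_sym perm_catCA.
Qed.

Definition swap_head {T : Type} (s : seq T) : seq T :=
  if s is [:: a, b & v] then [:: b, a & v] else s.

Lemma swap_headK {T : Type} : involutive (@swap_head T).
Proof. by case=> [|a []]. Qed.

Lemma perm_swap_head {T : eqType} (s : seq T) : perm_eq (swap_head s) s.
Proof. by case: s => [|a [|b v]] //=; rewrite (perm_catCA [:: b] [:: a] v). Qed.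

(** After [rotr 1] the two end letters are the first two, so this is a conjugate of [swap_head]. *)
Definition swap_ends {T : Type} (s : seq T) : seq T :=
  rot 1 (swap_head (rotr 1 s)).

Lemma swap_endsK {T : Type} : involutive (@swap_ends T).
Proof. by move=> s; rewrite /swap_ends rotK swap_headK rotrK. Qed.

Lemma perm_swap_ends {T : eqType} (s : seq T) : perm_eq (swap_ends s) s.
Proof. by rewrite /swap_ends perm_rot (permPl (perm_swap_head _)) perm_rot. Qed.

Lemma nth_rot1 {T : Type} (d : T) (s : seq T) (j : nat) :
  j.+1 < size s -> nth d (rot 1 s) j = nth d s j.+1.
Proof. by case: s => [//|a s] js; rewrite rot1_cons nth_rcons ifT. Qed.

(** The bound keeps [j.+1] strictly between the two end positions, the only ones that [swap_ends]
    alters. *)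
Lemma nth_rot1_swap_ends {T : Type} (d : T) (s : seq T) (j : nat) :
  j.+2 < size s -> nth d (rot 1 (swap_ends s)) j = nth d s j.+1.
Proof.
rewrite /swap_ends -{1 3}(rotrK 1 s) size_rot.
case: (rotr 1 s) => [|a [|b v]] // js.
have -> : rot 1 (rot 1 (swap_head [:: a, b & v])) = rcons (rcons v b) a.
  by rewrite [swap_head _]/= (rot1_cons b) rcons_cons rot1_cons.
by rewrite rot1_cons /= !nth_rcons size_rcons !ifT // ltnW.
Qed.

(** The multiset of letters forces the last letter once the others are known. *)
Lemma perm_eq_take_inj {T : eqType} (a b : seq T) :
  perm_eq a b -> take (size a).-1 a = take (size a).-1 b -> a = b.
Proof.
move=> ab; have := perm_size ab; move: ab.
case/lastP: a => [|a x]; case/lastP: b => [|b y] //; rewrite ?size_rcons //.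
rewrite -!cats1 /= => ab [sab]; rewrite take_size_cat // sab take_size_cat //.
move=> eab; move: ab; rewrite eab perm_cat2l => /perm_small_eq -> //.
Qed.

Lemma iter_mod {X : Type} (f : X -> X) (x : X) (N k : nat) :
  iter N f x = x -> iter (k %% N) f x = iter k f x.
Proof.
move=> fN; rewrite [in RHS](divn_eq k N) addnC iterD; congr iter.
by elim: (k %/ N) => //= q IH; rewrite mulSn iterD -IH fN.
Qed.

Section Words.

Variables (T : choiceType) (M : {mset T}).
Local Notation X := (mset_perms M).

Lemma mem_mset_perms (a : seq T) :
  (a \in mset_perms M) = perm_eq a (enum_mset M).
Proof. by rewrite !inE mem_permutations. Qed.

Lemma perm_val_mset_perms (x : X) : perm_eq (val x) (enum_mset M).
Proof. by rewrite -mem_mset_perms (valP x). Qed.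

Lemma lift_mset_perms (f : seq T -> seq T) : (forall s, perm_eq (f s) s) ->
  {F : X -> X | forall x, val (F x) = f (val x)}.
Proof.
move=> fP; exists (fun x => insubd x (f (val x))) => x.
by rewrite insubdK // unfold_in /= mem_mset_perms (permPl (fP _)) perm_val_mset_perms.
Qed.

Lemma mset_perms_cycle :
  exists2 g : {perm X},
    forall x, val (g x) = rot 1 (val x) \/ val (g x) = rot 1 (swap_ends (val x)) &
    forall x y, y \in porbit g x.
Proof.
have [r0 r0E] := lift_mset_perms (rot 1) (fun s => permEl (perm_rot 1 s)).
have [t tE] := lift_mset_perms _ perm_swap_ends.
have r_inj : injective r0.
  by move=> x y /(congr1 val); rewrite !r0E => /rot_inj /val_inj.
have tK : involutive t by move=> x; apply: val_inj; rewrite !tE swap_endsK.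
have [S rS tS x Sx y|g gP gtr] := exists_transitive_perm _ (perm r_inj) _ tK; last first.
  by exists g => // x; case: (gP x) => ->; rewrite permE r0E ?tE; [left | right].
(* [S] is finite and [r0]-stable, hence also stable under the inverse rotation. *)
have rotS z : z \in S -> exists2 z', z' \in S & val z = rot 1 (val z').
  move=> zS; have : perm r_inj @: S == S.
    rewrite eqEcard card_imset ?leqnn ?andbT; last exact: perm_inj.
    by apply/subsetP => _ /imsetP[w wS ->]; exact: rS.
  by move=> /eqP rSE; move: zS; rewrite -{1}rSE => /imsetP[w wS ->]; exists w; rewrite ?permE.
pose P s := exists2 z, z \in S & val z = s.
suff [z zS /val_inj <- //] : P (val y).
apply: (perm_closure P _ _ (val x)) => [_ [z zS <-]|a b s [z zS zE]||].
- by exists (perm r_inj z); [exact: rS | rewrite permE r0E].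
(* The word of [t (r z)] is the rotation of [swap_head] applied to that of [z]; [rotS] then undoes
   the rotation inside [S]. *)
- have : t (perm r_inj z) \in S by apply/tS/rS.
  move=> /rotS[w wS wE]; exists w => //; apply: (@rot_inj 1).
  by rewrite -wE tE permE r0E zE /swap_ends rotK.
- by rewrite (permPl (perm_val_mset_perms x)) perm_sym perm_val_mset_perms.
- by exists x.
Qed.

End Words.

Theorem lemma3p4 (T : choiceType) (n : nat) (M : {mset T})
    (hn : 0 < n) (hM : size M = n) :
  exists u : #|` prefix_repr n (mset_perms M)|.-tuple T, is_ucycle n.-1 u.
Proof.
have [g gP gtr] := mset_perms_cycle T M.
have szM : size (enum_mset M) = n by [].
have sz (x : mset_perms M) : size (val x) = n.
  by rewrite (perm_size (perm_val_mset_perms _ _ x)).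
have take_inj : {in mset_perms M &, injective (take n.-1)}.
  move=> a b; rewrite !mem_mset_perms => aM bM eab.
  apply: perm_eq_take_inj; first by rewrite (permPl aM) perm_sym.
  by rewrite (perm_size aM) szM.
have cardX : #|` prefix_repr n (mset_perms M)| = #|{: mset_perms M}|.
  by rewrite card_in_imfset // cardfE.
have MA : enum_mset M \in mset_perms M by rewrite mem_mset_perms.
pose x0 : mset_perms M := [` MA].
have [d _] : {d : T | true} by case: (enum_mset M) szM hn => [<- //|d]; exists d.
have step x j : j.+1 < n.-1 -> nth d (val (g x)) j = nth d (val x) j.+1.
  by move=> jn; case: (gP x) => ->; rewrite ?nth_rot1_swap_ends ?nth_rot1 // sz; lia.
(* Each step of [g] moves the inner letters one place left, so the first letters met from [x] on
   spell its prefix. *)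
have head_iter j x : j < n.-1 -> nth d (val (iter j g x)) 0 = nth d (val x) j.
  elim: j x => [//|j IH] x jn; rewrite iterSr IH; last exact: ltnW.
  exact: step.
have orbE x : #|porbit g x| = #|{: mset_perms M}|.
  by apply: eq_card => y; rewrite gtr.
set N := #|` _| in cardX *.
have iterN : iter N g x0 = x0 by rewrite cardX -(orbE x0) iter_porbit.
pose u : N.-tuple T := [tuple nth d (val (iter i g x0)) 0 | i < N].
(* The start is [g x0] rather than [x0] because the subword of index [i] begins at position [i + 1];
   [iterN] justifies the wrap modulo [N]. *)
have uE i : cyclic_subword u n.-1 i = take n.-1 (val (iter i g (g x0))).
  apply: (@eq_from_nth _ d) => [|j]; rewrite size_map size_iota.
    by rewrite size_take sz; case: ifP; lia.
  move=> jn; rewrite (nth_map 0) ?size_iota // nth_iota // add0n nth_take //.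
  have lt : (i + j.+1) %% N < N by rewrite ltn_mod; case: i {jn}; lia.
  rewrite -[_ %% _]/(val (Ordinal lt)) nth_mktuple /= iter_mod //.
  by rewrite addnS -addSn addnC iterD head_iter // iterSr.
exists u => c /imfsetP[a /= aA ->].
have /trajectP[i] : [` aA] \in traject g (g x0) N.
  by rewrite cardX -(orbE (g x0)) -porbit_traject gtr.
move=> iN ai; exists (Ordinal iN); split=> [|i']; rewrite uE; first by rewrite /= -ai.
move=> /take_inj; rewrite -[a]/(val [` aA]) ai => /(_ (valP _) (valP _)) /val_inj e.
(* Uniqueness: the [N] points of the orbit listed from [g x0] are distinct. *)
apply/val_inj/eqP => /=; have := uniq_traject_porbit g (g x0).
rewrite orbE -cardX => /(nth_uniq (g x0)) <-; rewrite ?size_traject //.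
by rewrite !nth_traject // e.
Qed.
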